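(* There exists a semigroup $U$ with an ideal $I$ such that both $I$ and the Rees quotient $U/I$ are stable but $U$ is not stable.
   Context: For a semigroup $S$, $S^1$ denotes the monoid obtained from $S$ by adjoining a new identity $1$. Green's preorders on $S$ are $a\leq_{\mathcal L}b\Leftrightarrow S^1a\subseteq S^1b$, $a\leq_{\mathcal R}b\Leftrightarrow aS^1\subseteq bS^1$, $a\leq_{\mathcal J}b\Leftrightarrow S^1aS^1\subseteq S^1bS^1$, with induced equivalence relations $\mathcal L,\mathcal R,\mathcal J$. A semigroup $S$ is stable if for all $a,s\in S$ both $sa\,\mathcal J\,a\Rightarrow sa\,\mathcal L\,a$ and $as\,\mathcal J\,a\Rightarrow as\,\mathcal R\,a$. An ideal of $S$ is a subset $I$ with $SI\subseteq I$ and $IS\subseteq I$; stability of $I$ refers to $I$ as a semigroup in its own right. The Rees quotient $S/I$ is the semigroup with underlying set $(S\setminus I)\sqcup\{0\}$ and multiplication $a\cdot b=ab$ if $a,b,ab\in S\setminus I$, and $a\cdot b=0$ otherwise. *)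

(* Defs.v *)
From HB Require Import structures.
From mathcomp Require Import all_boot classical_sets.

Set Implicit Arguments.
Unset Strict Implicit.
Unset Printing Implicit Defensive.

Local Open Scope classical_set_scope.
Local Open Scope group_scope.

(* S^1; None is the new identity, adjoined even when S already has one. *)
Definition adjoin1 (S : Type) : Type := option S.

Definition emb1 (S : Type) (a : S) : adjoin1 S := Some a.

Section Adjoin1.
Variable S : semigroupType.

Definition adjoin1_mul (x y : adjoin1 S) : adjoin1 S :=
  match x, y with
  | None, _ => y
  | _, None => x
  | Some a, Some b => Some (a * b)
  end.

Lemma adjoin1_mulA : associative adjoin1_mul.
Proof. by case=> [a|] [b|] [c|] //=; rewrite mulgA. Qed.

Lemma adjoin1_mul1 : left_id (None : adjoin1 S) adjoin1_mul.
Proof. by []. Qed.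

Lemma adjoin1_mulr1 : right_id (None : adjoin1 S) adjoin1_mul.
Proof. by case. Qed.

HB.instance Definition _ := Choice.copy (adjoin1 S) (option S).
HB.instance Definition _ := isSemigroup.Build (adjoin1 S) adjoin1_mulA.
HB.instance Definition _ :=
  Semigroup_isMonoid.Build (adjoin1 S) adjoin1_mul1 adjoin1_mulr1.
End Adjoin1.

Section Green.
Variable S : semigroupType.
Implicit Types a b s : S.

(* S^1 a, a S^1 and S^1 a S^1, as subsets of S^1. *)
Definition left_principal a : set (adjoin1 S) :=
  [set x * emb1 a | x in [set: adjoin1 S]].
Definition right_principal a : set (adjoin1 S) :=
  [set emb1 a * x | x in [set: adjoin1 S]].
Definition principal a : set (adjoin1 S) :=
  [set x * emb1 a * y | x in [set: adjoin1 S] & y in [set: adjoin1 S]].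

Definition leL a b : Prop := left_principal a `<=` left_principal b.
Definition leR a b : Prop := right_principal a `<=` right_principal b.
Definition leJ a b : Prop := principal a `<=` principal b.

Definition eqvL a b : Prop := leL a b /\ leL b a.
Definition eqvR a b : Prop := leR a b /\ leR b a.
Definition eqvJ a b : Prop := leJ a b /\ leJ b a.
End Green.

Definition stable (S : semigroupType) : Prop :=
  forall a s : S,
    (eqvJ (s * a) a -> eqvL (s * a) a) /\ (eqvJ (a * s) a -> eqvR (a * s) a).

Definition is_ideal (S : semigroupType) (I : set S) : Prop :=
  [set s * x | s in [set: S] & x in I] `<=` I /\
  [set x * s | x in I & s in [set: S]] `<=` I.

Section Ideal.
Variables (S : semigroupType) (I : set S).

Lemma ideal_mull : is_ideal I -> forall s x, x \in I -> s * x \in I.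
Proof. by move=> [hl _] s x /set_mem Ix; apply/mem_set/hl; exists s => //; exists x. Qed.

Lemma ideal_mulr : is_ideal I -> forall x s, x \in I -> x * s \in I.
Proof. by move=> [_ hr] x s /set_mem Ix; apply/mem_set/hr; exists x => //; exists s. Qed.

Lemma ideal_mulg_closed : is_ideal I -> mulg_closed (mem I).
Proof. by move=> hI x y _; apply: ideal_mull. Qed.
End Ideal.

(* The carriers below do not depend on the proof hI; it is a parameter of the
   types because their semigroup structures require it. *)
Definition ideal_semigroup (S : semigroupType) (I : set S)
  (hI : is_ideal I) : Type := {x : S | x \in I}.

Section IdealSemigroup.
Variables (S : semigroupType) (I : set S) (hI : is_ideal I).

HB.instance Definition _ := SubChoice.copy (ideal_semigroup hI) {x : S | x \in I}.
HB.instance Definition _ :=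
  SubChoice_isSubSemigroup.Build S (fun x => x \in I) (ideal_semigroup hI)
    (ideal_mulg_closed hI).
End IdealSemigroup.

(* (S \ I) with a zero None adjoined. *)
Definition rees_quotient (S : semigroupType) (I : set S)
  (hI : is_ideal I) : Type := option {x : S | x \in ~` I}.

Section ReesQuotient.
Variables (S : semigroupType) (I : set S) (hI : is_ideal I).

(* insub c is Some c when c is outside I, and None when c is in I. *)
Definition rees_mul (x y : rees_quotient hI) : rees_quotient hI :=
  match x, y with
  | Some a, Some b => insub (val a * val b)
  | _, _ => None
  end.

Lemma rees_mulA : associative rees_mul.
Proof.
have inI z : (z \notin ~` I) = (z \in I) by rewrite in_setC negbK.
have outI z : z \in I -> insub z = None :> option {x : S | x \in ~` I}.
  by rewrite -inI => zI; apply/insubN.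
case=> [a|] [b|] [c|] //=; do ?by case: insub.
case: (insubP _ (val b * val c)) => [v _ vE|];
  case: (insubP _ (val a * val b)) => [u _ uE|] //=.
- by rewrite uE vE mulgA.
- rewrite inI => abI; apply: outI.
  by rewrite -/(val v) vE mulgA; apply: ideal_mulr.
- rewrite inI => bcI; apply/esym/outI.
  by rewrite -/(val u) uE -mulgA; apply: ideal_mull.
Qed.

HB.instance Definition _ :=
  Choice.copy (rees_quotient hI) (option {x : S | x \in ~` I}).
HB.instance Definition _ := isSemigroup.Build (rees_quotient hI) rees_mulA.
End ReesQuotient.

(* Main.v *)
Require Import Defs.
From HB Require Import structures.
From mathcomp Require Import all_boot classical_sets.
From mathcomp Require Import ssrint zify.

Set Implicit Arguments.
Unset Strict Implicit.
Unset Printing Implicit Defensive.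

Local Open Scope classical_set_scope.
Local Open Scope group_scope.

(** Let the natural numbers act on the integers by [m z = z + m] on the left
    and [z n = z - n] on the right, and form the union of the naturals, the
    integers and a zero, where any product of two integers is zero.  The ideal
    of integers and zero is null and its Rees quotient is the naturals with a
    zero: both are commutative, hence stable.  But [1 0 1 = 0] makes the
    integer [1 = 1 0] J-equivalent to [0], while left multiplication never
    decreases an integer, so they are not L-equivalent. *)

Section CommutativeStable.
Variable S : semigroupType.
Hypothesis mulC : commutative (@mul S).

Lemma adjoin1_mulC : commutative (@mul (adjoin1 S)).
Proof. by case=> [a|] [b|] //; congr Some; apply: mulC. Qed.

Lemma principal_leftE (a : S) : principal a = left_principal a.
Proof.
apply/seteqP; split=> [_ [x _ [y _ <-]] | _ [x _ <-]].
  by exists (y * x) => //; rewrite -mulgA adjoin1_mulC.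
by exists x => //; exists 1 => //; rewrite mulg1.
Qed.

Lemma principal_rightE (a : S) : principal a = right_principal a.
Proof.
rewrite principal_leftE; apply/seteqP.
by split=> _ [x _ <-]; exists x => //; rewrite adjoin1_mulC.
Qed.

(** Both one-sided principal ideals equal the two-sided one, so L, R and J coincide. *)
Lemma commutative_stable : stable S.
Proof.
move=> a s; rewrite /eqvJ /eqvL /eqvR /leJ /leL /leR.
by split; rewrite ?principal_leftE // -!principal_leftE !principal_rightE.
Qed.

End CommutativeStable.

(* [inl n] is a natural number, [inr (Some z)] an integer, [inr None] the zero. *)
Definition shift_semigroup : Type := (nat + option int)%type.

Definition shift_mul (u v : shift_semigroup) : shift_semigroup :=
  match u, v with
  | inl m, inl n => inl (m + n)%N
  | inl m, inr (Some z) => inr (Some (z + m%:Z)%R)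
  | inr (Some z), inl n => inr (Some (z - n%:Z)%R)
  | _, _ => inr None
  end.

Lemma shift_mulA : associative shift_mul.
Proof.
by case=> [m|[x|]] [n|[y|]] [p|[z|]] //=; do ?[congr inl | congr (inr (Some _))]; lia.
Qed.

HB.instance Definition _ := Choice.copy shift_semigroup (nat + option int)%type.
HB.instance Definition _ := isSemigroup.Build shift_semigroup shift_mulA.

Definition shift_ideal : set shift_semigroup :=
  [set u | if u is inr _ then True else False].

Lemma shift_ideal_is_ideal : is_ideal shift_ideal.
Proof.
split=> _ [u Hu [v Hv <-]]; first by case: u v Hv {Hu} => [m|[x|]] [n|[y|]].
by case: u v Hu {Hv} => [m|[x|]] [n|[y|]].
Qed.

Lemma shift_ideal_mulC :
  commutative (@mul (ideal_semigroup shift_ideal_is_ideal)).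
Proof.
move=> u v; apply: val_inj.
case: u v => [u uI] [v vI]; move: (set_mem uI) (set_mem vI).
by case: u uI => [m|[x|]] uI //; case: v vI => [n|[y|]] vI.
Qed.

Lemma shift_rees_mulC :
  commutative (@mul (rees_quotient shift_ideal_is_ideal)).
Proof.
case=> [[u uI]|] [[v vI]|] //; congr insub => /=.
move: (set_mem uI) (set_mem vI).
(* [I] is the proof of [True]: no [inr w] lies in the complement of the ideal. *)
case: u uI => [m|w] uI; last by move=> /(_ I).
case: v vI => [n|w] vI; last by move=> _ /(_ I).
by move=> _ _; congr inl; apply: addnC.
Qed.

Lemma shift_not_stable : ~ stable shift_semigroup.
Proof.
pose a : shift_semigroup := inr (Some 0%R); pose s : shift_semigroup := inl 1%N.
move=> /(_ a s) [JL _].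
have aE : a = s * a * s by [].
have [] : eqvL (s * a) a.
  apply: JL; split=> _ [x _ [y _ <-]].
    by exists (x * emb1 s) => //; exists y => //; rewrite -[x * _ * _]mulgA.
  (* By [aE], [x * a * y] is [x * (s * a) * (s * y)]. *)
  exists x => //; exists (emb1 s * y) => //.
  by rewrite {2}aE !mulgA -[x * _ * emb1 s]mulgA.
move=> _ /(_ (emb1 a)) [|]; first by exists 1 => //; rewrite mul1g.
(* A left multiplier taking the integer 1 to 0 is sought: a natural [m] gives [1 + m], the adjoined
   identity gives 1, the rest give the zero. *)
case=> [[m|[z|]]|] _ //; case; lia.
Qed.

Theorem corollary5p12 :
  exists (U : semigroupType) (I : set U) (hI : is_ideal I),
    stable (ideal_semigroup hI) /\ stable (rees_quotient hI) /\ ~ stable U.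
Proof.
exists shift_semigroup, shift_ideal, shift_ideal_is_ideal.
split; first exact: commutative_stable shift_ideal_mulC.
by split; [apply: commutative_stable shift_rees_mulC | apply: shift_not_stable].
Qed.
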